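(* Let $p$ be a prime, let $\mathcal{R}$ be one of the rings $\mathbb{F}_{p^2}$ or $\mathbb{F}_p\times\mathbb{F}_p$, and let $C$ be a linear code over $\mathcal{R}$ of length $n$. For all admissible levels $\ell,\ell'$ with $\ell<\ell'$, $$\theta_{\Lambda_\ell(C)}(q)=\theta_{\Lambda_{\ell'}(C)}(q)+O\!\left(q^{\frac{\ell+1}{4}}\right).$$
   Context: Let $p$ be a prime and $\mathcal{R}=\mathbb{F}_{p^2}$ or $\mathcal{R}=\mathbb{F}_p\times\mathbb{F}_p$. A linear code $C$ of length $n$ over $\mathcal{R}$ is an $\mathcal{R}$-submodule of $\mathcal{R}^n$. For a square-free integer $\ell>0$ with $\ell\equiv 3\pmod 4$, let $K=\mathbb{Q}(\sqrt{-\ell})$ and let $\mathcal{O}_K=\mathbb{Z}[\omega_\ell]$, $\omega_\ell=\frac{-1+\sqrt{-\ell}}{2}$, be its ring of integers. Such an $\ell$ is an admissible level (for $\mathcal{R}$) if $\mathcal{O}_K/p\mathcal{O}_K$ is isomorphic to $\mathcal{R}$ as a ring. For each admissible $\ell$ fix such a ring isomorphism and let $\rho_{\ell,p}:\mathcal{O}_K\to\mathcal{O}_K/p\mathcal{O}_K\to\mathcal{R}$ be the resulting reduction map. Define the lattice (Construction A) $$\Lambda_\ell(C)=\{u=(u_1,\dots,u_n)\in\mathcal{O}_K^n : (\rho_{\ell,p}(u_1),\dots,\rho_{\ell,p}(u_n))\in C\},$$ and its theta series $\theta_{\Lambda_\ell(C)}(q)=\sum_{u\in\Lambda_\ell(C)}q^{u\cdot\bar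 u}$, where $u\cdot\bar u=\sum_{i=1}^n u_i\overline{u_i}$. This is a formal power series in $q$ with integer coefficients. For formal power series, $f(q)=g(q)+O(q^r)$ means that the coefficients of $q^i$ in $f$ and $g$ agree for all $i<r$. *)

(* Defs.v *)
From HB Require Import structures.
From mathcomp Require Import all_boot all_order all_algebra all_field.
From mathcomp Require Import ring_quotient generic_quotient.
From mathcomp Require Import boolp classical_sets functions cardinality fsbigop.
From mathcomp Require Import zify ring lra.

Set Implicit Arguments.
Unset Strict Implicit.
Unset Printing Implicit Defensive.

Import Order.TTheory GRing.Theory Num.Theory.
Local Open Scope quotient_scope.
Local Open Scope classical_set_scope.
Local Open Scope ring_scope.

Record level := Level {
  level_val :> nat;
  level_gt0 : (0 < level_val)%N;
  level_mod4 : (level_val %% 4 = 3)%N;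
  level_sqfree : forall d : nat, (d ^ 2 %| level_val)%N -> d = 1%N
}.

Definition sqrtNl (l : nat) : algC := sqrtC (- l%:R).

Definition omega (l : nat) : algC := (-1 + sqrtNl l) / 2.

(* Z[omega_l]; lemma [in_OK_integers] identifies it with the ring of integers
   of Q(sqrt(-l)). *)
Definition in_OK (l : level) : {pred algC} :=
  fun x => `[< exists P : {poly int}, x = (map_poly intr P).[omega l] >].

Lemma in_OK_subring_closed l : subring_closed (in_OK l).
Proof.
split.
- by apply/asboolP; exists 1; rewrite rmorph1 hornerC.
- move=> _ _ /asboolP[P ->] /asboolP[Q ->]; apply/asboolP; exists (P - Q).
  by rewrite rmorphB hornerD hornerN.
- move=> _ _ /asboolP[P ->] /asboolP[Q ->]; apply/asboolP; exists (P * Q).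
  by rewrite rmorphM hornerM.
Qed.

HB.instance Definition _ (l : level) :=
  GRing.isSubringClosed.Build algC (in_OK l) (in_OK_subring_closed l).

Record OK (l : level) := MkOK { OK_val :> algC; OK_valP : OK_val \in in_OK l }.

HB.instance Definition _ l := [isSub for @OK_val l].
HB.instance Definition _ l := [Choice of OK l by <:].
HB.instance Definition _ l := [SubChoice_isSubComNzRing of OK l by <:].

Lemma sqrtNl_sqr l : sqrtNl l ^+ 2 = - l%:R.
Proof. exact: sqrtCK. Qed.

Lemma level_quarter (l : level) : (l.+1 = (l.+1 %/ 4) * 4)%N.
Proof. have := level_mod4 l; lia. Qed.

Lemma omega_sqr (l : level) :
  omega l ^+ 2 = - omega l - (l.+1 %/ 4)%N%:R.
Proof.
have h := sqrtNl_sqr l.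
have : (l : nat)%:R + 1 = (l.+1 %/ 4)%N%:R * 4 :> algC.
  by rewrite natr1 -natrM -level_quarter.
rewrite /omega; move: (sqrtNl l) h ((l.+1 %/ 4)%N%:R) => w h m hm.
have -> : m = ((l : nat)%:R + 1) / 4 by rewrite hm; field.
have -> : (l : nat)%:R = - w ^+ 2 :> algC by rewrite h opprK.
by field.
Qed.

Lemma in_OKP (l : level) x :
  reflect (exists a b : int, x = a%:~R + b%:~R * omega l) (x \in in_OK l).
Proof.
apply: (iffP (asboolP _)) => [[P ->]|[a [b ->]]].
  elim/poly_ind: P => [|P c [a [b IH]]].
    by exists 0, 0; rewrite rmorph0 horner0 mul0r addr0.
  exists (c - b * (l.+1 %/ 4)%N%:Z), (a - b).
  rewrite rmorphD rmorphM /= map_polyX map_polyC /= hornerMXaddC IH.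
  have := omega_sqr l; move: (omega l) => w hw.
  rewrite !rmorphB rmorphM /= -[(Posz _)%:~R]/((l.+1 %/ 4)%N%:R).
  rewrite mulrDl -mulrA -expr2 hw; ring.
exists (a%:P + b%:P * 'X).
by rewrite rmorphD rmorphM /= map_polyX !map_polyC /= hornerD hornerMX !hornerC.
Qed.

Lemma omega_Aint (l : level) : omega l \in Aint.
Proof.
pose P : {poly int} := 'X^2 + ('X + (l.+1 %/ 4)%N%:Z%:P).
have sP : (size ('X + (l.+1 %/ 4)%N%:Z%:P : {poly int})%R
    < size ('X^2 : {poly int})%R)%N.
  by rewrite size_XaddC size_polyXn.
apply: (@root_monic_Aint (map_poly intr P)).
- rewrite /root /P !rmorphD /= map_polyXn map_polyX map_polyC /=.
  by rewrite !hornerD hornerXn hornerX hornerC omega_sqr addrA addrAC subrK addNr.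
- by rewrite monic_map // monicE lead_coefDl ?lead_coefXn.
- by apply/polyOverP => i; rewrite coef_map /= intr_int.
Qed.

Lemma OK_Aint (l : level) : {subset in_OK l <= Aint}.
Proof.
move=> x /in_OKP[a [b ->]].
by apply: rpredD; [|apply: rpredM]; rewrite ?omega_Aint //; exact: Aint_int.
Qed.

Lemma conj_sqrtNl (l : level) : (sqrtNl l)^* = - sqrtNl l.
Proof.
have h := sqrtNl_sqr l.
have : (sqrtNl l)^* ^+ 2 == sqrtNl l ^+ 2.
  by rewrite -rmorphXn /= h rmorphN /= conjC_nat.
rewrite eqf_sqr => /orP[/eqP/CrealP/real_exprn_even_ge0|/eqP//].
by move=> /(_ 2 isT); rewrite h oppr_ge0 lern0 => /eqP l0; have := level_gt0 l; rewrite l0.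
Qed.

Lemma normC4 (l : level) (a b : int) (x := a%:~R + b%:~R * omega l) :
  4 * (x * x^*) = ((2 * a - b) ^+ 2 + (l : nat)%:Z * b ^+ 2)%:~R.
Proof.
rewrite /x /omega !(rmorphXn, rmorphD, rmorphM, rmorphN, fmorphV, rmorph1, rmorph_nat) /=.
rewrite !rmorph_int conj_sqrtNl.
have := sqrtNl_sqr l; move: (sqrtNl l) => w hw.
rewrite -[(Posz _)%:~R]/((l : nat)%:R).
have -> : (l : nat)%:R = - w ^+ 2 :> algC by rewrite hw opprK.
by field.
Qed.

Lemma normC_OK (l : level) (a b : int) (x := a%:~R + b%:~R * omega l) :
  x * x^* = (a ^+ 2 - a * b + b ^+ 2 * (l.+1 %/ 4)%N%:Z)%:~R.
Proof.
apply: (@mulfI algC 4); first by rewrite pnatr_eq0.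
rewrite {}/x [LHS]normC4.
have -> : (l : nat)%:Z = (l.+1 %/ 4)%N%:Z * 4 - 1.
  by rewrite -PoszM -level_quarter; lia.
set k : int := (X in X%:~R = _); set N : int := (X in _ * X%:~R).
have -> : k = 4 * N by rewrite /k /N; ring.
by rewrite intrM.
Qed.


Lemma sqrtNl_neq0 (l : level) : sqrtNl l != 0.
Proof.
by rewrite sqrtC_eq0 oppr_eq0 pnatr_eq0 -lt0n level_gt0.
Qed.

Lemma sqfree_rat_int (l : level) (t : rat) :
  (l : nat)%:R * t ^+ 2 \is a Num.int -> t \is a Num.int.
Proof.
move=> /intrP[k hk].
have d0 : denq t != 0 := denq_neq0 t.
have e : (l : nat)%:Z * numq t ^+ 2 = k * denq t ^+ 2.
  apply: (@intr_inj rat); rewrite !(rmorphXn, rmorphM) /= -hk -[in t ^+ 2](divq_num_den t).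
  by rewrite -[(Posz _)%:~R]/((l : nat)%:R); field; rewrite intr_eq0.
have : (`|denq t| ^ 2 %| l)%N.
  have : (`|denq t| ^ 2 %| l * `|numq t| ^ 2)%N.
    by have := congr1 absz e; rewrite !(abszX, abszM) /= => ->; rewrite dvdn_mull.
  rewrite Gauss_dvdl // coprimeXl // coprimeXr // coprime_sym.
  exact: coprime_num_den.
move=> /level_sqfree d1.
have -> : t = (numq t)%:~R.
  by rewrite -[LHS]divq_num_den -[denq t]gez0_abs ?denq_ge0 // d1 divr1.
exact: intr_int.
Qed.

(* Z[omega_l] is the ring of integers of Q(sqrt(-l)). *)
Lemma in_OK_integers (l : level) :
  in_OK l =i [predI Aint & Crat_span [:: 1; sqrtNl l]].
Proof.
have span2 x : reflect (exists r s : rat, x = ratr r + ratr s * sqrtNl l)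
    (x \in Crat_span [:: 1; sqrtNl l]).
  apply: (iffP (Crat_spanP _ _)) => [[a ->]|[r [s ->]]].
    exists (a ord0), (a (lift ord0 ord0)).
    by rewrite !big_ord_recl big_ord0 /= addr0 mulr1.
  exists [ffun i : 'I_2 => if val i == 0%N then r else s].
  by rewrite !big_ord_recl big_ord0 /= !ffunE /= addr0 mulr1.
move=> x; rewrite inE /=; apply/idP/andP => [xO|[xA /span2[r [s hx]]]].
  split; first exact: OK_Aint xO.
  have /in_OKP[a [b ->]] := xO; apply/span2.
  exists (a%:~R - b%:~R / 2), (b%:~R / 2).
  by rewrite rmorphB !fmorph_div /= !ratr_int !ratr_nat /omega; field.
have hw := sqrtNl_sqr l.
have hc : x^* = ratr r - ratr s * sqrtNl l.
  have cr (z : rat) : (ratr z : algC)^* = ratr z by exact: conj_Crat (Crat_rat z).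
  rewrite hx rmorphD /= cr [(_ * sqrtNl l)^*]rmorphM /= cr conj_sqrtNl.
  by rewrite mulrN.
have cA : x^* \in Aint by rewrite Aint_aut.
have ratint (z : rat) : ratr z \in Aint -> z \is a Num.int.
  move=> /(Cint_rat_Aint (Crat_rat z)) /intrP[k hk].
  have -> : z = k%:~R by apply: (fmorph_inj (@ratr algC)); rewrite /= hk ratr_int.
  exact: intr_int.
have h1 : 2 * r \is a Num.int.
  apply: ratint; have -> : ratr (2 * r) = x + x^*.
    by rewrite hc hx rmorphM /= ratr_nat; ring.
  exact: rpredD.
have h2 : r ^+ 2 + (l : nat)%:R * s ^+ 2 \is a Num.int.
  apply: ratint.
  have -> : ratr (r ^+ 2 + (l : nat)%:R * s ^+ 2) = x * x^*.
    rewrite hc hx !(rmorphXn, rmorphD, rmorphM) /= ratr_nat.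
    by rewrite -[(l : nat)%:R]opprK -hw; ring.
  exact: rpredM.
have h3 : 2 * s \is a Num.int.
  apply: (@sqfree_rat_int l).
  have -> : (l : nat)%:R * (2 * s) ^+ 2
    = 4 * (r ^+ 2 + (l : nat)%:R * s ^+ 2) - (2 * r) ^+ 2 by ring.
  by rewrite rpredB ?rpredX // rpredM // intr_int.
case/intrP: h1 => a ha; case/intrP: h3 => b hb; case/intrP: h2 => N hN.
have e : a ^+ 2 + (l : nat)%:Z * b ^+ 2 = 4 * N.
  apply: (@intr_inj rat).
  rewrite !(rmorphXn, rmorphD, rmorphM) /= -hN -ha -hb.
  rewrite -[(Posz l)%:~R]/((l : nat)%:R); ring.
have [c hc2] : exists c : int, a + b = 2 * c.
  have l4 : exists m : int, (l : nat)%:Z = 4 * m + 3.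
    by exists (l %/ 4)%N%:Z; have := level_mod4 l; lia.
  case: l4 => m hm; rewrite hm in e.
  exists (((a + b) %/ 2)%Z).
  have : (((a + b) * (a + b)) = 2 * (2 * N - 2 * m * b ^+ 2 - b ^+ 2 + a * b))%R.
    by move: e; rewrite !expr2; lia.
  move: (2 * N - _ - _ + _) => k hk.
  have : exists q, (a + b = 2 * q \/ a + b = 2 * q + 1).
    by exists (((a + b) %/ 2)%Z); lia.
  by case=> q [->|hq]; [lia|exfalso; move: hk; rewrite hq; lia].
apply/in_OKP; exists c, b.
have two (z : rat) k : 2 * z = k%:~R -> ratr z = k%:~R / 2 :> algC.
  by move=> hz; rewrite -ratr_int -hz rmorphM /= ratr_nat; field.
rewrite hx (two _ _ ha) (two _ _ hb) /omega.
have -> : a = 2 * c - b by rewrite -hc2 addrK.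
by rewrite rmorphB rmorphM /= -[2%:~R]/(2%:R); field.
Qed.

(* The ideal p O_K. Primality of p only serves to make the ideal proper, as
   required by [{ideal_quot _}]. *)
Definition pOK (l : level) (p : nat) (p_pr : prime p) : {pred OK l} :=
  fun x => `[< exists y : OK l, x = p%:R * y >].

Lemma pOK_idealr_closed (l : level) (p : nat) (p_pr : prime p) :
  idealr_closed (@pOK l p p_pr).
Proof.
split.
- by apply/asboolP; exists 0; rewrite mulr0.
- apply/negP => /asboolP[y /(congr1 (@OK_val l))].
  have valM (u v : OK l) : OK_val (u * v) = OK_val u * OK_val v.
    exact: (rmorphM (val : OK l -> algC)).
  have valn : OK_val (p%:R : OK l) = p%:R.
    exact: (rmorph_nat (val : OK l -> algC)).
  have val1 : OK_val (1 : OK l) = 1 by exact: (rmorph1 (val : OK l -> algC)).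
  rewrite valM valn val1 => h.
  have p0 : p%:R != 0 :> algC by rewrite pnatr_eq0 -lt0n prime_gt0.
  have hy : OK_val y = p%:R^-1 by apply: (mulfI p0); rewrite -h divff.
  have : (p %| 1)%N.
    rewrite -eqAmod0_nat eqAmod0 unfold_in (negPf p0) mul1r -hy.
    exact: OK_Aint (OK_valP y).
  by rewrite Euclid_dvd1.
- move=> a _ _ /asboolP[u ->] /asboolP[v ->]; apply/asboolP.
  by exists (a * u + v); rewrite mulrDr mulrCA.
Qed.

HB.instance Definition _ (l : level) (p : nat) (p_pr : prime p) :=
  isIdealr.Build (OK l) (@pOK l p p_pr) (pOK_idealr_closed l p_pr).

Definition OKmod (l : level) (p : nat) (p_pr : prime p) : comNzRingType :=
  {ideal_quot (@pOK l p p_pr)}.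

Definition ring_isomorphic (A B : nzRingType) : Prop :=
  exists f : {rmorphism A -> B}, bijective f.

(* R is F_{p^2} or F_p x F_p, up to isomorphism. *)
Definition is_residue_ring (p : nat) (R : comNzRingType) : Prop :=
  (exists2 F : finFieldType, #|F| = (p ^ 2)%N & ring_isomorphic R F)
  \/ ring_isomorphic R ('F_p * 'F_p)%type.

Definition admissible (p : nat) (p_pr : prime p) (R : comNzRingType)
  (l : level) : Prop := ring_isomorphic (OKmod l p_pr) R.

Definition reduction (l : level) (p : nat) (p_pr : prime p)
  (R : comNzRingType) (phi : OKmod l p_pr -> R) : OK l -> R :=
  fun x => phi (\pi_(OKmod l p_pr) x).

Definition constructionA (l : level) (R : comNzRingType) (rho : OK l -> R)
  (n : nat) (C : {pred 'rV[R]_n}) : set 'rV[OK l]_n :=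
  [set u | map_mx rho u \in C].

(* u . ubar, computed in algC; a natural number by [hdot_nat]. *)
Definition hdot (l : level) (n : nat) (u : 'rV[OK l]_n) : algC :=
  \sum_(j < n) OK_val (u 0 j) * (OK_val (u 0 j))^*.

(* A formal power series over int is its coefficient sequence. *)
Definition fps := nat -> int.

(* The coefficient of q^i in sum_(u in L) q^(u . ubar) is the sum over L of the
   coefficients of q^i in the monomials q^(u . ubar); this sum has finite
   support by [theta_finite]. *)
Definition theta (l : level) (n : nat) (L : set 'rV[OK l]_n) : fps :=
  fun i => \sum_(u \in L) ((hdot u == i%:R)%:R : int).

(* f = g + O(q^r) *)
Definition eq_O (f g : fps) (r : nat) : Prop :=
  forall i : nat, (i < r)%N -> f i = g i.

Lemma hdot_nat (l : level) (n : nat) (u : 'rV[OK l]_n) : hdot u \is a Num.nat.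
Proof.
rewrite natrEint sumr_ge0 => [|j _]; last exact: mul_conjC_ge0.
rewrite andbT rpred_sum // => j _.
have /in_OKP[a [b ->]] := OK_valP (u 0 j).
by rewrite normC_OK intr_int.
Qed.

Lemma theta_finite (l : level) (n : nat) (L : set 'rV[OK l]_n) (i : nat) :
  finite_set [set u | L u /\ hdot u = i%:R].
Proof.
pose z (k : 'I_(4 * i).+1) : int := (k : nat)%:Z - (2 * i)%N%:Z.
have cP (k m : 'I_(4 * i).+1) :
    (z k)%:~R + (z m)%:~R * omega l \in in_OK l.
  by apply/in_OKP; exists (z k), (z m).
pose f (t : {ffun 'I_n -> 'I_(4 * i).+1 * 'I_(4 * i).+1}) : 'rV[OK l]_n :=
  \row_j MkOK (cP (t j).1 (t j).2).
apply: (@sub_finite_set _ _ (f @` setT)); last first.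
  by apply: finite_image; exact: finite_finset.
move=> u [_ hu].
have zP (a : int) : `|a| <= (2 * i)%N%:Z -> exists k, z k = a.
  move=> ha; have hk : (absz (a + (2 * i)%N%:Z)%R < (4 * i).+1)%N by lia.
  by exists (Ordinal hk); rewrite /z /=; lia.
have uP j : exists t : 'I_(4 * i).+1 * 'I_(4 * i).+1,
    u 0 j = MkOK (cP t.1 t.2).
  have [a [b hab]] := in_OKP _ _ (OK_valP (u 0 j)).
  have le : OK_val (u 0 j) * (OK_val (u 0 j))^* <= i%:R.
    rewrite -hu /hdot (bigD1 j) //= lerDl sumr_ge0 // => k _.
    exact: mul_conjC_ge0.
  have : 4 * (OK_val (u 0 j) * (OK_val (u 0 j))^* ) <= 4 * i%:R.
    by rewrite ler_pM2l ?ltr0n.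
  rewrite hab normC4 -natrM -[(4 * i)%N%:R]/((4 * i)%N%:Z%:~R) ler_int => le4.
  have l1 : 1 <= (l : nat)%:Z by have := level_gt0 l; lia.
  have hb : b ^+ 2 <= 4 * i%:Z.
    have h1 := sqr_ge0 (2 * a - b); have h2 := sqr_ge0 b.
    have : b ^+ 2 <= (l : nat)%:Z * b ^+ 2 by rewrite ler_peMl.
    by move: h1 le4; rewrite PoszM; lia.
  have ha : (2 * a - b) ^+ 2 <= 4 * i%:Z.
    have h2 : 0 <= (l : nat)%:Z * b ^+ 2 by rewrite mulr_ge0 ?sqr_ge0.
    by move: h2 le4; rewrite PoszM; lia.
  have bnd (c : int) : c ^+ 2 <= 4 * i%:Z -> `|c| <= (2 * i)%N%:Z.
    rewrite expr2 => hc; rewrite leNgt; apply/negP => hlt.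
    have : (2 * i)%N%:Z < `|c| by [].
    case: (lerP 0 c) => c0; nia.
  have /zP[m hm] := bnd _ hb.
  have /zP[k hk] : `|a| <= (2 * i)%N%:Z.
    have := bnd _ ha; have := bnd _ hb; lia.
  by exists (k, m); apply: val_inj; rewrite /= hm hk.
have [g hg] := choice uP.
by exists [ffun j => g j] => //; apply/rowP => j; rewrite mxE ffunE -hg.
Qed.

(* Main.v *)
Require Import Defs.
From HB Require Import structures.
From mathcomp Require Import all_boot all_order all_algebra all_field.
From mathcomp Require Import ring_quotient generic_quotient.
From mathcomp Require Import boolp classical_sets functions cardinality fsbigop.
From mathcomp Require Import zify.

(** An element [a + b omega] of [O_K] has norm [((2a - b)^2 + l b^2) / 4], so
    norm less than [(l + 1) / 4] forces [b = 0]: the vectors of small norm in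
    [Lambda_l(C)] are the integer vectors whose reduction lies in [C]. A ring
    morphism sends an integer [a] to [a * 1], so this set depends neither on [l]
    nor on the chosen isomorphism, and its norms are [sum_j a_j^2]. *)

Set Implicit Arguments.
Unset Strict Implicit.
Unset Printing Implicit Defensive.
Import Order.TTheory GRing.Theory Num.Theory.
Local Open Scope ring_scope.

Lemma OK_val_int (l : level) (a : int) : OK_val (a%:~R : OK l) = a%:~R.
Proof. exact: (rmorph_int (val : OK l -> algC)). Qed.

Lemma OK_small_norm (l : level) (x : OK l) (i : nat) :
  (i < (l + 1) %/ 4)%N -> OK_val x * (OK_val x)^* <= i%:R ->
  exists a : int, x = a%:~R.
Proof.
move=> lti; have [a [b hab]] := in_OKP _ _ (OK_valP x) => le.
have : 4 * (OK_val x * (OK_val x)^*) <= 4 * i%:R by rewrite ler_pM2l ?ltr0n.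
rewrite hab normC4 -natrM -[(4 * i)%N%:R]/((4 * i)%N%:Z%:~R) ler_int => le4.
(* If [b] were nonzero, [le4] would give [l <= l * b ^ 2 <= 4 * i], whereas [i < (l + 1) %/ 4]
   forces [4 * i <= l - 3]. *)
have b0 : b = 0.
  apply/eqP; apply: contraT => b_neq0.
  have b1 : 1 <= b ^+ 2 by have : 0 < b ^+ 2 by rewrite exprn_even_gt0.
  have : (l : nat)%:Z <= (l : nat)%:Z * b ^+ 2 by rewrite ler_peMr.
  by have := sqr_ge0 (2 * a - b); lia.
by exists a; apply: val_inj; rewrite /= OK_val_int hab b0 mul0r addr0.
Qed.

Lemma hdot_int (l : level) (n : nat) (v : 'rV[int]_n) :
  hdot (map_mx intr v : 'rV[OK l]_n) = (\sum_(j < n) v 0 j ^+ 2)%:~R.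
Proof.
rewrite rmorph_sum; apply: eq_bigr => j _.
by rewrite mxE OK_val_int rmorph_int -intrM.
Qed.

(** The terms of [hdot u] are nonnegative, so each coordinate has norm at most [i] and
    [OK_small_norm] applies to it. *)
Lemma hdot_small (l : level) (n : nat) (u : 'rV[OK l]_n) (i : nat) :
  (i < (l + 1) %/ 4)%N -> hdot u = i%:R -> exists v, map_mx intr v = u.
Proof.
move=> lti hu.
have /choice[f hf] j : exists a : int, u 0 j = a%:~R.
  apply: OK_small_norm lti _; rewrite -hu /hdot (bigD1 j) //= lerDl.
  by apply: sumr_ge0 => k _; exact: mul_conjC_ge0.
by exists (\row_j f j); apply/rowP => j; rewrite !mxE hf.
Qed.

Lemma intr_mx_inj (l : level) (n : nat) :
  injective (map_mx intr : 'rV[int]_n -> 'rV[OK l]_n).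
Proof.
move=> v w /rowP vw; apply/rowP => j; move/(congr1 (@OK_val l)): (vw j).
by rewrite !mxE !OK_val_int => /intr_inj.
Qed.

Lemma reduction_int (p : nat) (p_pr : prime p) (R : comNzRingType) (l : level)
    (phi : {rmorphism OKmod l p_pr -> R}) (a : int) :
  reduction phi a%:~R = a%:~R.
Proof. by rewrite /reduction !rmorph_int. Qed.

(** The right-hand side mentions neither [l] nor [phi], so it serves as a common value for comparing
    two levels. *)
Lemma theta_constructionA (p : nat) (p_pr : prime p) (R : comNzRingType)
    (l : level) (phi : {rmorphism OKmod l p_pr -> R}) (n : nat)
    (C : {pred 'rV[R]_n}) (i : nat) :
  (i < (l + 1) %/ 4)%N ->
  theta (constructionA (reduction phi) C) i =
  \sum_(v \in [set v | (map_mx intr v : 'rV[R]_n) \in C]%classic)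
    ((\sum_(j < n) v 0 j ^+ 2 == i)%:R : int).
Proof.
move=> lti; rewrite /theta.
set L := constructionA _ _; set D := [set v | _]%classic.
have LE v : L (map_mx intr v) = D v.
  rewrite /L /D /constructionA /=; congr (is_true (_ \in C)).
  by apply/rowP => j; rewrite !mxE reduction_int.
(* The sum over [L] shrinks to the image of [D]: by [hdot_small], a vector of [L] outside this image
   contributes 0 to the coefficient of [q^i]. *)
rewrite -(@fsbig_widen _ _ _ _ (map_mx intr @` D)%classic) /=; first last.
- move=> u [Lu nDu] /=; case: eqP => // /(hdot_small lti)[v vu].
  by case: nDu; exists v; rewrite // -LE vu.
- by move=> _ [v Dv <-]; rewrite LE.
rewrite (@reindex_fsbig _ _ _ _ _ (map_mx intr) D).
  by apply: eq_fsbigr => v _; rewrite hdot_int -[i%:R]/(i%:Z%:~R) eqr_int.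
split=> [v Dv|v w _ _|u]; [by exists v|exact: intr_mx_inj|by []].
Qed.

Theorem theorem13 (p : nat) (p_pr : prime p) (R : comNzRingType)
  (hR : is_residue_ring p R)
  (phi : forall l : level, admissible p_pr R l -> {rmorphism OKmod l p_pr -> R})
  (phi_bij : forall (l : level) (hl : admissible p_pr R l), bijective (phi l hl))
  (n : nat) (C : {pred 'rV[R]_n}) (hC : submod_closed C)
  (l l' : level) (hl : admissible p_pr R l) (hl' : admissible p_pr R l')
  (ltll' : (l < l')%N) :
  eq_O (theta (constructionA (reduction (phi l hl)) C))
       (theta (constructionA (reduction (phi l' hl')) C))
       ((l + 1) %/ 4).
Proof.
move=> i lti; rewrite !theta_constructionA //.
(* At level [l'] the bound on [i] follows from the one at [l], as [(l + 1) %/ 4] is monotone in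
   [l]. *)
by apply: leq_trans lti _; rewrite leq_div2r // leq_add2r ltnW.
Qed.
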